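(* For all integers $n,\alpha,\beta\in\mathbb{Z}_+$ with $\frac{n}{6}\ge\alpha\ge\beta$, every non-adaptive algorithm solving all instances of the Gap Edit Distance problem with parameters $\alpha,\beta$ on strings of length $n$ has expected query complexity $\Omega\big(\frac{n\sqrt{\beta}}{\alpha}\big)$ or error probability exceeding $\frac13$.
   Context: $\mathsf{ED}(X,Y)$ denotes the edit distance (minimum number of character insertions, deletions and substitutions transforming $X$ into $Y$). Gap Edit Distance with integer parameters $\alpha\ge\beta\ge 0$: given $X,Y\in\Sigma^n$, return YES if $\mathsf{ED}(X,Y)\le\beta$, NO if $\mathsf{ED}(X,Y)>\alpha$, and an arbitrary answer otherwise. Algorithms access $X,Y$ only via queries reading a single character at a position; an algorithm is non-adaptive if its (randomized) choice of queried positions does not depend on the answers to queries. $\Omega(\cdot)$ hides an absolute constant independent of $n,\alpha,\beta$. *)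

(* Defs.v *)
From HB Require Import structures.
From mathcomp Require Import all_boot all_order all_algebra.
From mathcomp Require Import all_classical all_reals all_analysis.

Set Implicit Arguments.
Unset Strict Implicit.
Unset Printing Implicit Defensive.

Import Order.TTheory GRing.Theory Num.Theory.

Local Open Scope classical_set_scope.
Local Open Scope ring_scope.

Section EditDistance.
Variable Sigma : eqType.
Implicit Types (X Y : seq Sigma).

Inductive edit_step : seq Sigma -> seq Sigma -> Prop :=
| edit_ins (s1 s2 : seq Sigma) (c : Sigma) :
    edit_step (s1 ++ s2) (s1 ++ c :: s2)
| edit_del (s1 s2 : seq Sigma) (c : Sigma) :
    edit_step (s1 ++ c :: s2) (s1 ++ s2)
| edit_sub (s1 s2 : seq Sigma) (c d : Sigma) :
    edit_step (s1 ++ c :: s2) (s1 ++ d :: s2).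

(* [edits k X Y]: some sequence of exactly [k] operations turns X into Y. *)
Fixpoint edits (k : nat) X Y : Prop :=
  if k is k'.+1 then exists2 Z, edit_step X Z & edits k' Z Y else X = Y.

Lemma edits_trans j k X Y Z : edits j X Y -> edits k Y Z -> edits (j + k) X Z.
Proof.
elim: j X => [|j IHj] X /=; first by move=> ->.
by case=> W XW WY YZ; exists W => //; exact: IHj.
Qed.

Lemma edits_to_nil X : edits (size X) X [::].
Proof.
elim: X => [|c X IHX] //=.
by exists X => //; exact: (edit_del [::] X c).
Qed.

Lemma edits_from_nil Y : edits (size Y) [::] Y.
Proof.
elim/last_ind: Y => [|Y c IHY] //=.
rewrite size_rcons -addn1; apply: edits_trans IHY _ => /=.
exists (rcons Y c) => //.
by have := edit_ins Y [::] c; rewrite cats0 cats1.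
Qed.

Lemma edits_exists X Y : exists k, `[< edits k X Y >].
Proof.
exists (size X + size Y)%N; apply/asboolP.
exact: edits_trans (edits_to_nil X) (edits_from_nil Y).
Qed.

Definition ED X Y : nat := ex_minn (edits_exists X Y).

End EditDistance.

Section NonAdaptive.
Variables (Sigma : eqType) (n : nat).

(* [inl i] is position i of X, [inr i] is position i of Y. *)
Definition position : finType := ('I_n + 'I_n)%type.

Definition char_at (X Y : n.-tuple Sigma) (p : position) : Sigma :=
  match p with inl i => tnth X i | inr i => tnth Y i end.

Definition answers : Type := {ffun position -> option Sigma}.

(* What is learned by querying exactly the positions in Q: unqueried
   positions carry [None]. *)
Definition view (Q : {set position}) (X Y : n.-tuple Sigma) : answers :=
  [ffun p => if p \in Q then Some (char_at X Y p) else None].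

(* A randomized non-adaptive algorithm whose random source is the measurable
   space T: the queried positions are a function of the randomness alone, and
   the answer (true for YES) is a function of the randomness and of the
   characters read. *)
Record nonadaptive_alg d (T : measurableType d) := NonadaptiveAlg {
  queries : T -> {set position};
  decide : T -> answers -> bool;
  measurable_queries :
    forall Q : {set position}, measurable [set w | queries w = Q];
  measurable_decide :
    forall v : answers, measurable [set w | decide w v]
}.

Section Run.
Variables (d : measure_display) (T : measurableType d).
Variable A : nonadaptive_alg T.

Definition output (w : T) (X Y : n.-tuple Sigma) : bool :=
  decide A w (view (queries A w) X Y).

Lemma measurable_output (X Y : n.-tuple Sigma) :
  measurable [set w | output w X Y].
Proof.
have -> : [set w | output w X Y] =
    \big[setU/set0]_(Q : {set position})
      ([set w | queries A w = Q] `&` [set w | decide A w (view Q X Y)]).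
  apply/seteqP; split=> w /=.
    by move=> ow; rewrite (bigD1 (queries A w)) //=; left.
  elim/big_ind: _ => //= [U V UH VH [/UH|/VH]//|Q _ [<-]//].
by apply: bigsetU_measurable => Q _; apply: measurableI;
  [exact: measurable_queries|exact: measurable_decide].
Qed.

End Run.
End NonAdaptive.

Section GapEditDistance.
Variables (Sigma : eqType) (n alpha beta : nat).

(* [ans] is a wrong answer on (X, Y); when beta < ED X Y <= alpha no answer
   is wrong. *)
Definition gap_wrong (X Y : n.-tuple Sigma) (ans : bool) : bool :=
  ((ED X Y <= beta)%N && ~~ ans) || ((alpha < ED X Y)%N && ans).

Variables (R : realType) (d : measure_display) (T : measurableType d).
Variables (P : probability T R) (A : nonadaptive_alg Sigma n T).

Definition error_probability (X Y : n.-tuple Sigma) : \bar R :=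
  P [set w | gap_wrong X Y (output A w X Y)].

Lemma measurable_error (X Y : n.-tuple Sigma) :
  measurable [set w | gap_wrong X Y (output A w X Y)].
Proof.
have mo := measurable_output A X Y; rewrite /gap_wrong.
case: (ED X Y <= beta)%N; case: (alpha < ED X Y)%N => /=.
- rewrite [X in measurable X](_ : _ = setT) //.
  by apply/seteqP; split=> w //= _; rewrite orNb.
- rewrite [X in measurable X](_ : _ = ~` [set w | output A w X Y]).
    exact: measurableC.
  by apply/seteqP; split=> w /=; rewrite orbF => /negP.
- exact: mo.
- rewrite [X in measurable X](_ : _ = set0) //.
  by apply/seteqP; split=> w.
Qed.

Definition expected_queries : \bar R :=
  'E_P[fun w => #|queries A w|%:R].

End GapEditDistance.

(* Main.v *)
Require Import Defs.
From HB Require Import structures.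
From mathcomp Require Import all_boot all_order all_algebra.
From mathcomp Require Import all_classical all_reals all_analysis.
From mathcomp Require Import measurable_realfun lra ring.
From mathcomp Require Import zify.
Import Order.TTheory GRing.Theory Num.Theory.
Local Open Scope ring_scope.

Set Implicit Arguments.
Unset Strict Implicit.
Unset Printing Implicit Defensive.

(** Cut the positions into about n / (6 alpha) blocks of length L = 6 alpha and
    plant the whole difference between the two strings in one hidden block.
    On YES inputs the block holds a uniform binary word U in the first string
    and U rotated by a uniform s <= beta / 2 in the second; on NO inputs it
    holds two independent uniform words, which are at edit distance more than
    alpha except with probability 1/12. Reading q characters of the block
    reveals a pair of matching offsets for at most q^2 shifts s, and for every
    other shift the two inputs look alike. As min(1, q^2/S) <= q / sqrt S,
    where S > beta / 2 is the number of shifts, telling them apart costs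
    Omega(sqrt beta) expected queries in every block.

    The bound on the edit distance of random words is a union bound over
    alignments, run through the recursion of Levenshtein's algorithm; it needs
    alpha >= 330. For smaller alpha the words a...a and b...b of length
    alpha + 1 in the hidden block already force Omega(n / alpha) queries. *)

(** * Levenshtein's recursion as a lower bound on the edit distance *)

Section Levenshtein.
Variable Sigma : eqType.
Implicit Types (X Y Z t : seq Sigma) (c e : Sigma).

Fixpoint lev X :=
  fix levX Y : nat :=
    match X, Y with
    | c :: X', e :: Y' =>
        minn (lev X' Y' + (c != e)) (minn (lev X' Y).+1 (levX Y').+1)
    | [::], _ => size Y
    | _, [::] => size X
    end.

Arguments lev : simpl never.

Lemma lev0s Y : lev [::] Y = size Y. Proof. by case: Y. Qed.

Lemma levs0 X : lev X [::] = size X. Proof. by case: X. Qed.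

Lemma lev_cons c X e Y : lev (c :: X) (e :: Y) =
  minn (lev X Y + (c != e)) (minn (lev X (e :: Y)).+1 (lev (c :: X) Y).+1).
Proof. by []. Qed.

Lemma lev_refl X : lev X X = 0%N.
Proof. by elim: X => // c X IH; rewrite lev_cons IH eqxx min0n. Qed.

Lemma lev_ins X e Y : (lev X (e :: Y) <= (lev X Y).+1)%N.
Proof. by case: X => [|c X]; rewrite ?lev0s // lev_cons; lia. Qed.

Lemma lev_consl c X Y : (lev (c :: X) Y <= (lev X Y).+1)%N.
Proof. by case: Y => [|e Y]; rewrite ?levs0 // lev_cons; lia. Qed.

Lemma lev_del X e Y : (lev X Y <= (lev X (e :: Y)).+1)%N.
Proof.
elim: X => [|c X IH]; first by rewrite !lev0s /=; lia.
by have := lev_consl c X Y; rewrite lev_cons; lia.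
Qed.

Lemma lev_behead c X Y : (lev X Y <= (lev (c :: X) Y).+1)%N.
Proof.
elim: Y => [|e Y IH]; first by rewrite !levs0 /=; lia.
by have := lev_ins X e Y; rewrite lev_cons; lia.
Qed.

Lemma lev_sub X e c Y : (lev X (e :: Y) <= (lev X (c :: Y)).+1)%N.
Proof.
elim: X => [|f X IH]; first by rewrite !lev0s /=; lia.
by rewrite !lev_cons; lia.
Qed.

(** The recursion at [c :: X] consults both [lev X Z] and [lev (c :: X) Z], hence the hypothesis for
    all [X]. This carries a single edit past the letters in front of it. *)
Lemma lev_step_cons e Y Z : (forall X, lev X Z <= (lev X Y).+1)%N ->
  (forall X, lev X (e :: Z) <= (lev X (e :: Y)).+1)%N.
Proof.
move=> YZ; elim=> [|c X IH]; first by have := YZ [::]; rewrite !lev0s /=; lia.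
by have := YZ X; have := YZ (c :: X); rewrite !lev_cons; lia.
Qed.

Lemma lev_step X Y Z : edit_step Y Z -> (lev X Z <= (lev X Y).+1)%N.
Proof.
case=> s1 s2 c => [||d]; elim: s1 X => [|e s1 IH] X.
- exact: lev_ins.
- exact: lev_step_cons.
- exact: lev_del.
- exact: lev_step_cons.
- exact: lev_sub.
- exact: lev_step_cons.
Qed.

Lemma lev_edits k X Y Z : edits k Y Z -> (lev X Z <= lev X Y + k)%N.
Proof.
elim: k Y => [|k IH] Y /=; first by move=> ->; rewrite addn0.
by case=> W /(lev_step X) YW /IH; lia.
Qed.

Lemma edits_ED X Y : edits (ED X Y) X Y.
Proof. by rewrite /ED; case: ex_minnP => k /asboolP. Qed.

Lemma ED_le k X Y : edits k X Y -> (ED X Y <= k)%N.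
Proof. by move=> e; rewrite /ED; case: ex_minnP => j _; apply; apply/asboolP. Qed.

(** Along an optimal edit sequence, [lev X] starts at [lev X X = 0] and grows by at most one per
    edit. *)
Lemma lev_le_ED X Y : (lev X Y <= ED X Y)%N.
Proof. by have := lev_edits X (edits_ED X Y); rewrite lev_refl. Qed.

(** The diagonal branch equals [lev X Y], and the other two cannot go below it by [lev_del] and
    [lev_behead]. *)
Lemma lev_cancel c X Y : (lev X Y <= lev (c :: X) (c :: Y))%N.
Proof.
by have := lev_del X c Y; have := lev_behead c X Y; rewrite lev_cons; lia.
Qed.

Lemma lev_cancel_cat t X Y : (lev X Y <= lev (t ++ X) (t ++ Y))%N.
Proof. by elim: t => //= c t IH; apply: leq_trans IH (lev_cancel _ _ _). Qed.

Lemma lev_size X Y : (size X <= size Y + lev X Y)%N /\ (size Y <= size X + lev X Y)%N.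
Proof.
elim: X Y => [|c X IHX] Y; first by rewrite lev0s /=; lia.
elim: Y => [|e Y IHY]; first by rewrite levs0 /=; lia.
have := IHX Y; have := IHX (e :: Y); rewrite lev_cons /= in IHY *; lia.
Qed.

Lemma edits_cat k t u X Y : edits k X Y -> edits k (t ++ X ++ u) (t ++ Y ++ u).
Proof.
elim: k X => [|k IH] X /=; first by move=> ->.
case=> W XW /IH WY; exists (t ++ W ++ u) => //.
case: XW => s1 s2 c => [||d]; rewrite -!catA !(catA t s1) ?cat_cons.
- exact: edit_ins.
- exact: edit_del.
- exact: edit_sub.
Qed.

(** Delete the first [s] letters of [X], then insert them again at its end. *)
Lemma edits_rot s t u X : (s <= size X)%N ->
  edits (s + s) (t ++ X ++ u) (t ++ rot s X ++ u).
Proof.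
move=> sX; apply: edits_cat.
have sz : size (take s X) = s by rewrite size_takel.
apply: (@edits_trans _ s s _ (drop s X)).
  rewrite -{1}(cat_take_drop s X).
  by have := edits_cat [::] (drop s X) (edits_to_nil (take s X)); rewrite sz.
by have := edits_cat (drop s X) [::] (edits_from_nil (take s X)); rewrite sz !cats0.
Qed.

Lemma count_edits (p : pred Sigma) k X Y : edits k X Y ->
  (count p Y <= count p X + k)%N.
Proof.
elim: k X => [|k IH] X /=; first by move=> ->; rewrite addn0.
by case=> W [] s1 s2 c => [||d] /IH; rewrite !count_cat /=; lia.
Qed.

(** * Counting binary words in an edit ball *)

Fixpoint words (a b : Sigma) m : seq (seq Sigma) :=
  if m is m'.+1 then
    map (cons a) (words a b m') ++ map (cons b) (words a b m')
  else [:: [::]].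

Lemma size_words a b m V : V \in words a b m -> size V = m.
Proof.
elim: m V => [|m IH] V /=; first by rewrite inE => /eqP->.
by rewrite mem_cat => /orP[] /mapP[W /IH <- ->].
Qed.

Lemma length_words a b m : size (words a b m) = (2 ^ m)%N.
Proof. by elim: m => //= m IH; rewrite size_cat !size_map IH expnS; lia. Qed.

Lemma mem_words a b V : all (mem [:: a; b]) V -> V \in words a b (size V).
Proof.
elim: V => //= c V IH /andP[+ /IH VW]; rewrite !inE mem_cat.
by case/orP => /eqP->; rewrite map_f ?orbT.
Qed.

(** The tail [t] is what follows the block: common prefixes get cancelled, common suffixes stay. The
    strict inequality makes the count zero at [d = 0], where the recursion stops. *)
Definition ball_count a b X t m d :=
  count (fun V => lev (X ++ t) (V ++ t) < d)%N (words a b m).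

Lemma ball_count_le a b X t m d : (ball_count a b X t m d <= 2 ^ m)%N.
Proof. by rewrite -(length_words a b m) count_size. Qed.

Lemma ball_count_eq0 a b X t m d :
  (d <= size X - m)%N || (d <= m - size X)%N -> ball_count a b X t m d = 0%N.
Proof.
move=> dX; apply/eqP; rewrite -leqn0 leqNgt -has_count; apply/hasP => -[V /size_words sV].
by have := lev_size (X ++ t) (V ++ t); rewrite !size_cat sV; lia.
Qed.

(** The terms stand for match, substitution, deletion and insertion in the first column. As
    [a != b], the letter [c] matches at most one of the two possible first letters; an insertion
    leaves that letter free, hence the doubling. *)
Lemma ball_count_rec a b c X t m d : a != b ->
  (ball_count a b (c :: X) t m.+1 d.+1 <=
   ball_count a b X t m d.+1 + ball_count a b X t m d +
   ball_count a b X t m.+1 d + (ball_count a b (c :: X) t m d).*2)%N.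
Proof.
move=> ab; rewrite /ball_count /= !count_cat !count_map.
elim: (words a b m) => //= V s IH; move: IH.
do ![set k := count _ _].
rewrite !lev_cons.
have : ((c != a) || (c != b)) by rewrite -negb_and; apply: contra ab => /andP[/eqP<-].
case: (c != a) => /=; case: (c != b) => //= _; lia.
Qed.

(* A generating function bound: [lam], [x], [y] mark an edit, a letter of X and
   a letter of V, and the last hypothesis says that the weights of the possible
   first columns of an alignment sum to at most 1. *)
Lemma ball_count_bound (R : realFieldType) (lam x y : R) a b X t m d :
  a != b -> 0 <= lam <= 1 -> 0 <= x -> 0 <= y -> lam * x <= 1 -> 2 * (lam * y) <= 1 ->
  (1 + lam) * (x * y) + lam * x + 2 * (lam * y) <= 1 ->
  (ball_count a b X t m d)%:R * lam ^+ d * x ^+ size X * y ^+ m <= lam.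
Proof.
move=> ab /andP[l0 l1] x0 y0 lx ly lxy.
have lamX (k e : nat) : (k < e)%N -> lam ^+ e <= lam * lam ^+ k.
  by move=> ke; rewrite -exprS ler_wiXn2l.
elim: X m d => [|c X IHX] m d.
  (* With [X] empty the distance is at least [m], so only [d > m] counts, and then
     [2 * (lam * y) <= 1] absorbs the [2 ^ m] words. *)
  rewrite expr0 mulr1; have [dm|md] := leqP d m.
    by rewrite ball_count_eq0 ?mul0r //= subn0 dm orbT.
  apply: (@le_trans _ _ ((2 * y) ^+ m * (lam * lam ^+ m))).
    rewrite exprMn -natrX mulrAC ler_pM ?mulr_ge0 ?exprn_ge0 ?lamX //.
    by rewrite ler_wpM2r ?exprn_ge0 // ler_nat ball_count_le.
  rewrite mulrCA -exprMn ler_piMr // exprn_ile1 ?mulr_ge0 //.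
  by rewrite mulrAC -mulrA.
elim: m d => [|m IHm] d.
  rewrite expr0 mulr1; have [dm|md] := leqP d (size X).+1.
    by rewrite ball_count_eq0 ?mul0r //= subn0 dm.
  apply: (@le_trans _ _ (lam * lam ^+ (size X).+1 * x ^+ (size X).+1)).
    rewrite ler_wpM2r ?exprn_ge0 // -[leRHS]mul1r ler_pM ?exprn_ge0 ?lamX //.
    by rewrite (ler_nat _ _ 1) ball_count_le.
  by rewrite -mulrA -exprMn ler_piMr // exprn_ile1 ?mulr_ge0.
case: d => [|d].
  by rewrite /ball_count (eq_count (a2 := pred0)) ?count_pred0 ?mul0r // => V; rewrite ltn0.
have := ball_count_rec c X t m d ab; rewrite -(ler_nat R) -mul2n natrD natrM !natrD.
move: (IHX m d.+1) (IHX m d) (IHX m.+1 d) (IHm d); rewrite [size (_ :: _)]/= !exprS.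
set N1 := (ball_count a b X t m d.+1)%:R; set N2 := (ball_count a b X t m d)%:R.
set N3 := (ball_count a b X t m.+1 d)%:R; set N4 := (ball_count a b (c :: X) t m d)%:R.
set N := _%:R; set L := lam ^+ d; set P := x ^+ _; set Q := y ^+ m => H1 H2 H3 H4 H.
have p0 : 0 <= (lam * L) * (x * P) * (y * Q) by rewrite !mulr_ge0 ?exprn_ge0.
rewrite -!mulrA [X in N * X](_ : _ = (lam * L) * (x * P) * (y * Q)); last by ring.
apply: le_trans (ler_wpM2r p0 H) _; apply: le_trans (ler_piMr l0 lxy).
(* The four induction hypotheses enter with weights [x * y], [lam * x * y], [lam * x] and
   [2 * lam * y], whose sum is at most 1 by [lxy]. *)
have := lerD (lerD (ler_wpM2l (mulr_ge0 x0 y0) H1) (ler_wpM2l (mulr_ge0 l0 (mulr_ge0 x0 y0)) H2))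
  (lerD (ler_wpM2l (mulr_ge0 l0 x0) H3) (ler_wpM2l (mulr_ge0 (ler0n R 2) (mulr_ge0 l0 y0)) H4)).
by congr (_ <= _); ring.
Qed.

(* The weights lam = 2/45, x = 13/10, y = 13/20 satisfy
   lam * (2 x y)^6 >= 31/30, and (31/30)^330 >= 1 + 330/30 = 12. *)
Lemma ball_count_small (R : realFieldType) a b X t al : a != b ->
  (330 <= al)%N -> size X = (6 * al)%N ->
  (ball_count a b X t (6 * al) al.+1)%:R <= 12^-1 * 2 ^+ (6 * al) :> R.
Proof.
move=> ab al_large sX.
have : (ball_count a b X t (6 * al) al.+1)%:R * (2 / 45) ^+ al.+1 *
    (13 / 10) ^+ (6 * al) * (13 / 20) ^+ (6 * al) <= 2 / 45 :> R.
  by rewrite -{2}sX; apply: ball_count_bound => //; lra.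
set N : R := _%:R; have N0 : 0 <= N by [].
(* One of the [al.+1] factors 2/45 cancels against the bound 2/45, which leaves
   [N * r ^+ al <= 1]. *)
set r : R := 2 / 45 * (169 / 200) ^+ 6.
rewrite [X in X <= _](_ : _ = 2 / 45 * (N * r ^+ al)); last first.
  rewrite exprS /r [in RHS]exprMn -[in RHS]exprM -!mulrA -exprMn.
  rewrite (_ : 13 / 10 * (13 / 20) = 169 / 200); last by field.
  by ring.
rewrite -[leRHS]mulr1 ler_pM2l; last by lra.
have r0 : 0 < r by rewrite /r; lra.
have rb : 1 + 1 / 30 <= r * 2 ^+ 6 by rewrite /r; lra.
have big : 12 <= r ^+ al * 2 ^+ (6 * al).
  rewrite [X in _ * X]exprM -exprMn.
  apply: (@le_trans _ _ ((1 + 1 / 30) ^+ al)); last first.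
    have q0 : 0 <= 1 + 1 / 30 :> R by lra.
    by apply: lerXn2r (q0) (le_trans q0 rb) rb.
  have B k : 1 + 1 / 30 * k%:R <= (1 + 1 / 30) ^+ k :> R.
    elim: k => [|k IH]; first by rewrite mulr0 addr0.
    rewrite exprS -[k.+1%:R]natr1; have : 0 <= k%:R :> R by [].
    by move: IH; set q := _ ^+ k; set u := k%:R => IH u0; lra.
  apply: le_trans (B al); have a0 : 330 <= al%:R :> R by rewrite ler_nat.
  by lra.
move=> H; have p0 : 0 < r ^+ al by rewrite exprn_gt0.
rewrite mulrC ler_pdivlMr // -(ler_pM2r p0) mulrAC; apply: le_trans (_ : 12 <= _).
  by rewrite -[leRHS]mul1r ler_wpM2r.
by rewrite mulrC.
Qed.

End Levenshtein.

(** * Acceptance probabilities and the expected number of queries *)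

Section Queries.
Local Open Scope classical_set_scope.
Variables (Sigma : eqType) (n alpha beta : nat) (R : realType).
Variables (d : measure_display) (T : measurableType d) (P : probability T R).
Variable A : nonadaptive_alg Sigma n T.
Implicit Types X Y : n.-tuple Sigma.

Lemma output_yes X Y : (ED X Y <= beta)%N ->
  (error_probability alpha beta P A X Y <= (1 / 3)%:E)%E ->
  ((2 / 3)%:E <= P [set w | output A w X Y])%E.
Proof.
move=> XY; have mO := measurable_output A X Y.
move=> err; have : (P (~` [set w | output A w X Y]) <= (1 / 3)%:E)%E.
  apply: le_trans err; apply: le_measure; rewrite ?inE.
  - exact: measurableC.
  - exact: measurable_error.
  - by move=> w /= /negP nw; rewrite /gap_wrong XY nw.
rewrite probability_setC // -(fineK (fin_num_measure P _ mO)) -EFinB !lee_fin.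
by lra.
Qed.

Lemma output_no X Y : (alpha < ED X Y)%N ->
  (error_probability alpha beta P A X Y <= (1 / 3)%:E)%E ->
  (P [set w | output A w X Y] <= (1 / 3)%:E)%E.
Proof.
move=> XY; apply: le_trans; apply: le_measure; rewrite ?inE.
- exact: measurable_output.
- exact: measurable_error.
- by move=> w /= ow; rewrite /gap_wrong XY ow orbT.
Qed.

Lemma measurable_card_queries :
  measurable_fun setT (fun w => #|queries A w|%:R : R).
Proof.
rewrite (_ : (fun w => _) =
  fun w => \sum_(Q : {set position n}) #|Q|%:R * \1_[set w | queries A w = Q] w).
  apply: measurable_sum => Q; apply: measurable_funM => //.
  exact/measurable_indic/measurable_queries.
apply/funext => w; rewrite (bigD1 (queries A w)) //= big1 ?addr0.
  by rewrite indicE mem_set // mulr1.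
by move=> Q Qw; rewrite indicE memNset ?mulr0 // => wQ; rewrite -wQ eqxx in Qw.
Qed.

Lemma integral_outputs (I : finType) (F : I -> n.-tuple Sigma * n.-tuple Sigma) (k : R) :
  0 <= k ->
  (\int[P]_w (k * \sum_i (output A w (F i).1 (F i).2)%:R)%:E =
   k%:E * \sum_i P [set w | output A w (F i).1 (F i).2])%E.
Proof.
move=> k0; have mO i := measurable_output A (F i).1 (F i).2.
have E w i : (output A w (F i).1 (F i).2)%:R =
    \1_[set w | output A w (F i).1 (F i).2] w :> R by rewrite indicE mem_setE.
under eq_integral => w _ do
  (rewrite EFinM -sumEFin; under eq_bigr => i _ do rewrite E).
have mI i : measurable_fun setT
    (fun w => (\1_[set w | output A w (F i).1 (F i).2] w : R)%:E).
  exact/measurable_EFinP/measurable_indic.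
rewrite ge0_integralZl //.
- rewrite ge0_integral_sum //; first by congr (_ * _)%E; apply: eq_bigr => i _;
    rewrite integral_indic // setIT.
- by apply: emeasurable_sum.
- by move=> w _; apply: sume_ge0 => i _; rewrite lee_fin.
Qed.

(** For fixed [w] the algorithm is deterministic; the pointwise inequality is integrated over
    [w]. *)
Lemma sum_outputs_le (I J : finType) (F : I -> n.-tuple Sigma * n.-tuple Sigma)
    (G : J -> n.-tuple Sigma * n.-tuple Sigma) (ki kj K : R) :
  0 <= ki -> 0 <= kj -> 0 <= K ->
  (forall w, ki * \sum_i (output A w (F i).1 (F i).2)%:R <=
     kj * \sum_j (output A w (G j).1 (G j).2)%:R + K * #|queries A w|%:R) ->
  (ki%:E * \sum_i P [set w | output A w (F i).1 (F i).2] <=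
   kj%:E * \sum_j P [set w | output A w (G j).1 (G j).2] +
   K%:E * expected_queries P A)%E.
Proof.
move=> ki0 kj0 K0 FG; have mQ := measurable_card_queries.
rewrite -(integral_outputs F ki0) -(integral_outputs G kj0) /expected_queries expectation.unlock.
have -> : (K%:E * \int[P]_w (#|queries A w|%:R)%:E =
    \int[P]_w (K * #|queries A w|%:R)%:E)%E.
  under [RHS]eq_integral do rewrite EFinM.
  by rewrite ge0_integralZl //; exact/measurable_EFinP.
have mS (H : finType) (E : H -> n.-tuple Sigma * n.-tuple Sigma) k :
    measurable_fun setT (fun w => (k * \sum_i (output A w (E i).1 (E i).2)%:R : R)%:E).
  apply/measurable_EFinP/measurable_funM => //.
  rewrite (_ : (fun w => _) = fun w => \sum_i \1_[set w | output A w (E i).1 (E i).2] w).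
    by apply: measurable_sum => i; exact/measurable_indic/measurable_output.
  by apply/funext => w; apply: eq_bigr => i _; rewrite indicE mem_setE.
rewrite -ge0_integralD //; last 3 first.
- by move=> w _; rewrite lee_fin mulr_ge0 ?sumr_ge0.
- by move=> w _; rewrite lee_fin mulr_ge0.
- by apply/measurable_EFinP/measurable_funM.
apply: ge0_le_integral => //.
- by move=> w _; rewrite lee_fin mulr_ge0 ?sumr_ge0.
- by apply: emeasurable_funD => //; apply/measurable_EFinP/measurable_funM.
- by move=> w _; rewrite -EFinD lee_fin.
Qed.

End Queries.

(** * Yao's averaging argument *)

Section Cost.
Local Open Scope classical_set_scope.
Variables (Sigma : eqType) (n alpha beta : nat) (R : realType).
Variables (d : measure_display) (T : measurableType d) (P : probability T R).
Variable A : nonadaptive_alg Sigma n T.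

(** Mean acceptance is at least 2/3 over the YES pairs [F] and at most [1 / 3 + eps] over [G]. Since
    the queries ignore the input, the last hypothesis only has to treat a fixed query set [Q] and
    decision rule [D]. *)
Lemma expected_queries_ge (I J : finType) (F : I -> n.-tuple Sigma * n.-tuple Sigma)
    (G : J -> n.-tuple Sigma * n.-tuple Sigma) (K eps : R) :
  (0 < #|I|)%N -> (0 < #|J|)%N -> 0 <= K ->
  (forall X Y, (error_probability alpha beta P A X Y <= (1 / 3)%:E)%E) ->
  (forall i, (ED (F i).1 (F i).2 <= beta)%N) ->
  #|[pred j | (ED (G j).1 (G j).2 <= alpha)%N]|%:R <= eps * #|J|%:R ->
  (forall (Q : {set position n}) (D : answers Sigma n -> bool),
    #|I|%:R^-1 * \sum_i (D (view Q (F i).1 (F i).2))%:R <=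
    #|J|%:R^-1 * \sum_j (D (view Q (G j).1 (G j).2))%:R + K * #|Q|%:R) ->
  ((1 / 3 - eps)%:E <= K%:E * expected_queries P A)%E.
Proof.
move=> I0 J0 K0 err yes no FG.
have nI : 0 < #|I|%:R :> R by rewrite ltr0n.
have nJ : 0 < #|J|%:R :> R by rewrite ltr0n.
have := @sum_outputs_le _ _ _ _ _ P A I J F G #|I|%:R^-1 #|J|%:R^-1 K.
rewrite !invr_ge0 !ler0n => /(_ isT isT K0 (fun w => FG _ _)) H.
have {H} : ((2 / 3)%:E <= (1 / 3 + eps)%:E + K%:E * expected_queries P A)%E.
  apply: le_trans (le_trans _ H) _.
    apply: (@le_trans _ _ (#|I|%:R^-1%:E * \sum_(i : I) (2 / 3)%:E)%E).
      by rewrite sumEFin -EFinM lee_fin sumr_const -[_ *+ #|_|]mulr_natr mulrCA mulVf ?mulr1 ?gt_eqF.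
    apply: lee_wpmul2l; first by rewrite lee_fin invr_ge0.
    by apply: lee_sum => i _; exact: output_yes (yes i) (err _ _).
  apply: leeD2r.
  (* The indicator pays for the pairs of [G] that are not NO instances, where acceptance is only
     bounded by 1. *)
  apply: (@le_trans _ _ (#|J|%:R^-1%:E *
      \sum_j (1 / 3 + (ED (G j).1 (G j).2 <= alpha)%N%:R : R)%:E)%E).
    apply: lee_wpmul2l; first by rewrite lee_fin invr_ge0.
    apply: lee_sum => j _; case: leqP => [_|far]; last first.
      by rewrite addr0; exact: output_no far (err _ _).
    apply: le_trans (probability_le1 _ _) _; first exact: measurable_output.
    by rewrite lee_fin /=; lra.
  rewrite sumEFin -EFinM lee_fin big_split /= sumr_const -natr_sum.
  rewrite -[_ / _ *+ _]mulr_natr mulrDr mulrCA mulVf ?mulr1 ?gt_eqF // lerD2l.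
  rewrite mulrC ler_pdivrMr //; apply: le_trans no; rewrite ler_nat.
  rewrite -sum1_card [leqRHS]big_mkcond; apply: leq_sum => j _.
  by rewrite inE; case: ifP.
move=> H; apply: (@le_trans _ _ ((2 / 3)%:E - (1 / 3 + eps)%:E)%E).
  by rewrite -EFinB lee_fin; lra.
by rewrite leeBlDl.
Qed.
End Cost.

(** * Planted blocks and the shifts that clash with the queries *)

Section Blocks.
Variables (Sigma : eqType) (a b : Sigma) (n L' : nat).
(** The successor form makes ['I_L] the group of residues modulo [L], so that a rotation is a
    translation of offsets. *)
Let L := L'.+1.
Implicit Types (U V W : {ffun 'I_L -> bool}) (j : nat).

Definition letter (x : bool) : Sigma := if x then b else a.

(* [inZp i] is the offset [i %% L] of position i in its block. *)
Definition planted j U : n.-tuple Sigma :=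
  [tuple if (i %/ L == j)%N then letter (U (inZp i)) else a | i < n].

Definition idx (p : position n) : nat := match p with inl i => i | inr i => i end.

Definition probes (Q : {set position n}) j : {set position n} :=
  [set p in Q | (idx p %/ L == j)%N].

Definition rotate (s : 'I_L) U : {ffun 'I_L -> bool} := [ffun i => U (i + s)].

Definition spell U : seq Sigma := [seq letter (U i) | i <- enum 'I_L].

Lemma size_spell U : size (spell U) = L.
Proof. by rewrite size_map size_enum_ord. Qed.

Lemma nth_spell U i : (i < L)%N -> nth a (spell U) i = letter (U (inZp i)).
Proof.
move=> iL; rewrite (nth_map ord0) ?size_enum_ord //; congr (letter (U _)).
by apply: val_inj; rewrite /= nth_enum_ord ?modn_small.
Qed.

Lemma plantedE j U : (j.+1 * L <= n)%N ->
  tval (planted j U) = nseq (j * L) a ++ spell U ++ nseq (n - j.+1 * L) a.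
Proof.
move=> jL; apply: (@eq_from_nth _ a).
  by rewrite size_tuple !size_cat !size_nseq size_spell; lia.
move=> i; rewrite size_tuple => ilt.
rewrite -[LHS](tnth_nth a _ (Ordinal ilt)) tnth_mktuple /=.
rewrite !nth_cat !nth_nseq size_nseq size_spell.
have -> : (i %/ L == j)%N = (j * L <= i < j.+1 * L)%N.
  by rewrite eqn_leq -ltnS ltn_divLR // leq_divRL // andbC.
case: (ltnP i (j * L)) => ji //=.
have -> : (i < j.+1 * L)%N = (i - j * L < L)%N by lia.
case: (ltnP (i - j * L) L) => ij; last by case: ifP.
rewrite nth_spell //.
congr (letter (U _)); apply: val_inj => /=.
by rewrite -{1}(subnKC ji) modnMDl.
Qed.

Lemma spell_rotate s U : spell (rotate s U) = rot s (spell U).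
Proof.
apply: (@eq_from_nth _ a); first by rewrite size_rot !size_spell.
move=> i; rewrite size_spell => iL; rewrite nth_spell // ffunE.
rewrite nth_cat size_drop nth_drop size_spell.
have sL : (s < L)%N := ltn_ord s.
case: ltnP => h; last rewrite nth_take; last by lia.
  rewrite nth_spell; last by lia.
  by congr (letter (U _)); apply: val_inj; rewrite /= modnDml addnC.
rewrite nth_spell; last by lia.
congr (letter (U _)); apply: val_inj; rewrite /= modnDml.
by rewrite -[in LHS](subnK h) -addnA subnK ?modnDr // ltnW.
Qed.

Lemma ED_planted_rotate j s U : (j.+1 * L <= n)%N ->
  (ED (planted j U) (planted j (rotate s U)) <= s + s)%N.
Proof.
move=> jL; rewrite !plantedE // spell_rotate; apply: ED_le; apply: edits_rot.
by rewrite size_spell ltnW.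
Qed.

Lemma view_planted (Q : {set position n}) j U U' V V' :
  (forall i : 'I_n, inl i \in probes Q j -> U (inZp i) = U' (inZp i)) ->
  (forall i : 'I_n, inr i \in probes Q j -> V (inZp i) = V' (inZp i)) ->
  view Q (planted j U) (planted j V) = view Q (planted j U') (planted j V').
Proof.
move=> UU VV; apply/ffunP => p; rewrite !ffunE; case: ifP => // pQ; congr Some.
by case: p pQ => i iQ /=; rewrite !tnth_mktuple; case: ifP => // ij;
  rewrite ?UU ?VV // inE iQ.
Qed.

(** Offset [i] of the first string and offset [p] of the second carry the same letter of [U] when
    [s = i - p]. Differences of all pairs of probes, whichever string they lie in, form a superset
    of these shifts. *)
Definition clash (Q : {set position n}) j : {set 'I_L} :=
  [set inZp (idx p.1) - inZp (idx p.2) | p in finset.setX (probes Q j) (probes Q j)].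

Lemma card_clash Q j : (#|clash Q j| <= #|probes Q j| ^ 2)%N.
Proof. by rewrite (leq_trans (leq_imset_card _ _)) // cardsX. Qed.

(* Exchange U and V on the offsets read from the second string: this involution
   of the pairs (U, V) turns a view of independent words into a view of rotated
   ones. *)
Lemma sum_view_rotate (R : realType) (Q : {set position n}) (D : answers Sigma n -> bool) j s :
  s \notin clash Q j ->
  \sum_(U : {ffun 'I_L -> bool}) \sum_(V : {ffun 'I_L -> bool})
    (D (view Q (planted j U) (planted j (rotate s U))))%:R =
  \sum_(U : {ffun 'I_L -> bool}) \sum_(V : {ffun 'I_L -> bool})
    (D (view Q (planted j U) (planted j V)))%:R :> R.
Proof.
(* [C] contains every offset of [U] that the second string reveals; as [s] does not clash, no probe
   of the first string has its offset in [C]. *)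
move=> sNc; pose C := [set @inZp L' (idx p) + s | p in probes Q j].
pose mix U V : {ffun 'I_L -> bool} := [ffun i => if i \in C then V i else U i].
have mixK U V : mix (mix U V) (mix V U) = U.
  by apply/ffunP => i; rewrite !ffunE; do ![case: ifP].
have rotK U : rotate s (rotate (- s) U) = U.
  by apply/ffunP => i; rewrite !ffunE addrK.
have rotK' U : rotate (- s) (rotate s U) = U.
  by apply/ffunP => i; rewrite !ffunE subrK.
rewrite !pair_big /=.
pose W := {ffun 'I_L -> bool}.
(* Rotation permutes the words, so the independent second word may be renamed [rotate s V]; its
   probes then read [V] only on [C]. *)
rewrite [RHS](reindex (fun q : W * W => (q.1, rotate s q.2))) /=; last first.
  by exists (fun q : W * W => (q.1, rotate (- s) q.2)) => -[U V] _ /=; rewrite ?rotK ?rotK'.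
rewrite (reindex (fun q => (mix q.1 q.2, mix q.2 q.1))) /=; last first.
  by exists (fun q => (mix q.1 q.2, mix q.2 q.1)) => -[U V] _ /=; rewrite !mixK.
apply: eq_bigr => -[U V] _ /=; congr (D _)%:R; apply: view_planted => i ij.
  rewrite ffunE; case: ifP => // /imsetP[p pj ip]; case/negP: sNc.
  apply/imsetP; exists (inl i, p); first by rewrite inE ij pj.
  by rewrite /= ip addrC addKr.
by rewrite !ffunE (imset_f (fun p => inZp (idx p) + s) ij).
Qed.

End Blocks.

(** Every position lies in a single block, so the [m] blocks share one query budget; this is the
    source of the factor [m] in the query bounds. *)
Lemma sum_card_probes n L' (Q : {set position n}) m :
  (\sum_(j < m) #|probes L' Q j| <= #|Q|)%N.
Proof.
under eq_bigr do rewrite -sum1_card big_mkcond /=.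
rewrite exchange_big /= -sum1_card [leqRHS]big_mkcond; apply: leq_sum => p _.
case: ifP => pQ; last by rewrite big1 // => j _; rewrite inE pQ.
apply: (@leq_trans (\sum_(j < m) (j == idx p %/ L'.+1 :> nat))).
  by apply: leq_sum => j _; rewrite inE pQ eq_sym /=; case: eqP.
case: (ltnP (idx p %/ L'.+1) m) => h; last first.
  by rewrite big1 // => j _; case: eqP => // jE; have := ltn_ord j; lia.
rewrite (bigD1 (Ordinal h)) //= eqxx big1 // => j jh.
by apply/eqP; rewrite eqb0; apply: contra jh => /eqP jE; apply/eqP/val_inj.
Qed.

(** * The advantage gained in one block *)

Section Hard.
Variables (Sigma : eqType) (a b : Sigma) (n L' : nat) (R : realType).
Hypothesis ab : a != b.
Let L := L'.+1.
Local Notation plant := (@planted Sigma a b n L').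
Let M : R := (2 ^ L)%:R.

Lemma card_word : #|{ffun 'I_L -> bool}| = (2 ^ L)%N.
Proof. by rewrite card_ffun card_bool card_ord. Qed.

(** The count is at most [S] and, [inZp] being injective below [L], at most the square of the number
    of probes; a minimum is at most the geometric mean. *)
Lemma card_clash_shift (S : nat) (Q : {set position n}) j : (S <= L)%N ->
  #|[set s : 'I_S | inZp s \in clash L' Q j]|%:R <= Num.sqrt S%:R * #|probes L' Q j|%:R :> R.
Proof.
move=> SL; set c := #|_|; set q := #|_|.
have cS : (c <= S)%N by rewrite -[leqRHS]card_ord max_card.
have cq : (c <= q ^ 2)%N.
  apply: leq_trans _ (card_clash _ _ _).
  rewrite /c -(@card_in_imset _ _ (fun s : 'I_S => @inZp L' s)); last first.
    move=> s t _ _ /(congr1 val) /=.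
    by rewrite !modn_small ?(leq_trans (ltn_ord _) SL) // => /val_inj.
  apply: fintype.subset_leq_card; apply/fintype.subsetP => x /imsetP[s]; rewrite inE => h ->.
  exact: h.
have S0 : 0 <= Num.sqrt S%:R :> R := sqrtr_ge0 _.
have SS : Num.sqrt S%:R * Num.sqrt S%:R = S%:R :> R by rewrite -expr2 sqr_sqrtr.
have [qS|Sq] := leP q%:R (Num.sqrt S%:R : R).
  apply: (@le_trans _ _ (q ^ 2)%:R); first by rewrite ler_nat.
  by rewrite natrX expr2 ler_wpM2r.
apply: (@le_trans _ _ S%:R); first by rewrite ler_nat.
by rewrite -{1}SS ler_wpM2l // ltW.
Qed.

(** A shift outside [clash] gives the same total as independent words, a clashing one at most
    [M * M]. The factor [M] on the left is the idle sum over [V] in [sum_view_rotate]. *)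
Lemma rotation_advantage (S : nat) (Q : {set position n}) (D : answers Sigma n -> bool) j :
  (S <= L)%N ->
  M * \sum_(s < S) \sum_U (D (view Q (plant j U) (plant j (rotate (inZp s) U))))%:R <=
  S%:R * (\sum_U \sum_V (D (view Q (plant j U) (plant j V)))%:R) +
  M * M * (Num.sqrt S%:R * #|probes L' Q j|%:R) :> R.
Proof.
move=> SL; set g := \sum_U \sum_V _.
have M0 : 0 <= M by [].
apply: (@le_trans _ _ (\sum_(s < S) (g + M * M * (inZp s \in clash L' Q j)%:R))); last first.
  rewrite big_split /= sumr_const card_ord -[g *+ _]mulr_natl lerD2l -mulr_sumr.
  rewrite ler_wpM2l ?mulr_ge0 //; apply: le_trans (card_clash_shift Q j SL).
  rewrite -natr_sum ler_nat -sum1_card [leqRHS]big_mkcond.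
  by apply: leq_sum => s _; rewrite inE; case: ifP.
rewrite mulr_sumr; apply: ler_sum => s _.
case: (boolP (inZp s \in clash L' Q j)) => [_|sN].
  rewrite mulr1 -[leLHS]add0r lerD //; first by do 2!apply: sumr_ge0 => ? _.
  rewrite ler_wpM2l // -[leRHS]mulr1 mulr_natl -card_word -sumr_const.
  by apply: ler_sum => U _; case: (D _).
rewrite mulr0 addr0 /g -(sum_view_rotate a b R D sN) mulr_sumr; apply: ler_sum => U _.
by rewrite sumr_const card_word mulr_natl.
Qed.

(** Pass from [ED] down to [lev] and cancel the common prefix. As [spell] is injective, the count is
    at most a [ball_count] whose tail is the padding after the block. *)
Lemma ED_planted_ball (al j : nat) U : (j.+1 * L <= n)%N ->
  L = (6 * al)%N -> (330 <= al)%N ->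
  #|[pred V | (ED (plant j U) (plant j V) <= al)%N]|%:R <= 12^-1 * M.
Proof.
move=> jL La al_large; rewrite /M natrX La.
pose t := nseq (n - j.+1 * L) a.
apply: le_trans (ball_count_small R t ab al_large (X := spell a b U) _); last first.
  by rewrite size_spell.
rewrite ler_nat cardE -(size_map (@spell Sigma a b L')) /ball_count -size_filter.
apply: uniq_leq_size.
  rewrite map_inj_uniq ?enum_uniq // => V W VW; apply/ffunP => i.
  have := congr1 (fun s => nth a s i) VW; rewrite !nth_spell // valZpK /letter.
  by move/eqP: ab => ?; case: (V i); case: (W i) => // /esym.
move=> _ /mapP[V + ->]; rewrite mem_enum inE mem_filter => VU; apply/andP; split.
  rewrite ltnS; apply: leq_trans VU; apply: leq_trans (lev_le_ED _ _).
  by rewrite !plantedE // lev_cancel_cat.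
have -> : (6 * al)%N = size (spell a b V) by rewrite size_spell.
apply: mem_words; apply/allP => _ /mapP[i _ ->].
by rewrite /letter !inE; case: (V i); rewrite eqxx ?orbT.
Qed.

End Hard.

Lemma card_pred_prod (I J : finType) (p : I -> J -> bool) :
  #|[pred x : I * J | p x.1 x.2]| = (\sum_i #|[pred j | p i j]|)%N.
Proof.
rewrite -sum1_card (eq_bigl (fun x => predT x.1 && p x.1 x.2)) //.
by rewrite -(pair_big_dep predT p (fun _ _ => 1%N)); apply: eq_bigr => i _; rewrite sum1_card.
Qed.

(** * Query bounds for the two hard distributions *)

Section LowerBounds.
Variables (Sigma : eqType) (a b : Sigma) (n alpha beta : nat) (R : realType).
Variables (d : measure_display) (T : measurableType d) (P : probability T R).
Variable A : nonadaptive_alg Sigma n T.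
Hypothesis ab : a != b.
Hypothesis err : forall X Y, (error_probability alpha beta P A X Y <= (1 / 3)%:E)%E.

(** The constant is 1/3 - 1/12. There are [beta./2.+1] shifts because rotating by [s] takes up to
    [2 * s] edits, which must not exceed [beta]. *)
Lemma queries_random_block : (330 <= alpha)%N -> (6 * alpha <= n)%N -> (beta <= alpha)%N ->
  ((1 / 4)%:E <= (((n %/ (6 * alpha))%:R * Num.sqrt (beta./2.+1)%:R)^-1)%:E *
    expected_queries P A)%E.
Proof.
move=> al_large aln ba; have [L' L'E] : exists L', L'.+1 = (6 * alpha)%N.
  by exists (6 * alpha).-1; rewrite prednK; lia.
rewrite -L'E; set m := (n %/ L'.+1)%N; set S := beta./2.+1; set r := Num.sqrt _.
have m0 : (0 < m)%N by rewrite divn_gt0 // L'E.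
have SL : (S <= L'.+1)%N by rewrite L'E /S; lia.
have mL (j : 'I_m) : (j.+1 * L'.+1 <= n)%N.
  by rewrite (leq_trans _ (leq_trunc_div n L'.+1)) // leq_mul2r ltn_ord orbT.
pose W := {ffun 'I_L'.+1 -> bool}.
pose F (x : 'I_m * 'I_S * W) :=
  (planted a b n x.1.1 x.2, planted a b n x.1.1 (rotate (inZp x.1.2) x.2)).
pose G (x : 'I_m * (W * W)) := (planted a b n x.1 x.2.1, planted a b n x.1 x.2.2).
have S0 : 0 < S%:R :> R by rewrite ltr0n.
have r0 : 0 < r by rewrite sqrtr_gt0.
have rr : S%:R = r ^+ 2 :> R by rewrite sqr_sqrtr.
have mR : 0 < m%:R :> R by rewrite ltr0n.
have M0 : 0 < (2 ^ L'.+1)%:R :> R by rewrite ltr0n expn_gt0.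
have := @expected_queries_ge Sigma n alpha beta R d T P A _ _ F G (m%:R * r)^-1 12^-1.
rewrite (_ : 1 / 3 - 12^-1 = 1 / 4); last by lra.
rewrite !card_prod !card_ord !card_word; apply => //.
- by rewrite !muln_gt0 m0 expn_gt0.
- by rewrite !muln_gt0 m0 expn_gt0.
- by rewrite invr_ge0 mulr_ge0 // ltW.
- move=> [[j s] U]; apply: leq_trans (ED_planted_rotate _ _ _ _ (mL j)) _ => /=.
  have := leq_mod s L'.+1; have := ltn_ord s; rewrite /S.
  move: (s %% L'.+1)%N => k; move: (nat_of_ord s) => t; lia.
- rewrite (card_pred_prod (fun (j : 'I_m) (u : W * W) =>
    ED (planted a b n j u.1) (planted a b n j u.2) <= alpha)%N).
  rewrite natr_sum natrM mulrCA mulr_natl -[X in _ *+ X]card_ord -sumr_const.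
  apply: ler_sum => j _.
  rewrite (card_pred_prod (fun U V : W =>
    ED (planted a b n j U) (planted a b n j V) <= alpha)%N).
  rewrite natr_sum natrM mulrCA mulr_natl -[X in _ *+ X](card_word L') -sumr_const.
  by apply: ler_sum => U _; exact: ED_planted_ball.
move=> Q D.
pose f (j : 'I_m) : R := \sum_(s < S) \sum_(U : W)
  (D (view Q (planted a b n j U) (planted a b n j (rotate (inZp s) U))))%:R.
pose g (j : 'I_m) : R := \sum_(U : W) \sum_(V : W)
  (D (view Q (planted a b n j U) (planted a b n j V)))%:R.
have -> : \sum_i (D (view Q (F i).1 (F i).2))%:R = \sum_j f j.
  by rewrite /f; under [RHS]eq_bigr do rewrite pair_big; rewrite !pair_big;
    rewrite (reindex (fun x : 'I_m * ('I_S * W) => (x.1, x.2.1, x.2.2))) //;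
    exists (fun x => (x.1.1, (x.1.2, x.2))) => [[j [s U]]|[[j s] U]].
have -> : \sum_i (D (view Q (G i).1 (G i).2))%:R = \sum_j g j.
  by rewrite /g; under [RHS]eq_bigr do rewrite pair_big; rewrite pair_big.
have H : (2 ^ L'.+1)%:R * \sum_j f j <=
    S%:R * \sum_j g j + (2 ^ L'.+1)%:R * (2 ^ L'.+1)%:R * (r * #|Q|%:R).
  apply: (@le_trans _ _ (S%:R * \sum_j g j + (2 ^ L'.+1)%:R * (2 ^ L'.+1)%:R *
    (r * (\sum_(j < m) #|probes L' Q j|)%:R))).
    rewrite natr_sum !mulr_sumr -big_split; apply: ler_sum => j _.
    exact: rotation_advantage.
  by rewrite lerD2l ler_wpM2l ?mulr_ge0 // ler_wpM2l ?(ltW r0) // ler_nat sum_card_probes.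
move: H; rewrite !natrM rr; set M := (2 ^ _)%:R in M0 *.
set f' := \sum_j f j; set g' := \sum_j g j => H.
(* This factor turns both totals into means: there are [m * S * M] YES pairs and [m * M * M] pairs
   with independent words. *)
have K0 : 0 < (m%:R * r ^+ 2 * M * M)^-1 by rewrite invr_gt0 !mulr_gt0 ?exprn_gt0.
rewrite -(ler_pM2l K0) in H.
apply: le_trans (le_trans _ H) _; rewrite le_eqVlt; apply/orP; left; apply/eqP.
  by field; rewrite !gt_eqF.
by field; rewrite !gt_eqF.
Qed.

(** The YES instance is [(Z, Z)] with [Z] all [a]; a NO instance turns one block of the second
    string into [alpha.+1] letters [b]. The views differ only if that block is probed. *)
Lemma queries_constant_block : (alpha < n)%N ->
  ((1 / 3)%:E <= ((n %/ alpha.+1)%:R^-1)%:E * expected_queries P A)%E.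
Proof.
move=> aln; set m := (n %/ alpha.+1)%N.
have m0 : (0 < m)%N by rewrite divn_gt0.
have mR : 0 < m%:R :> R by rewrite ltr0n.
pose Z := planted a b n 0 ([ffun=> false] : {ffun 'I_alpha.+1 -> bool}).
pose B j := planted a b n j ([ffun=> true] : {ffun 'I_alpha.+1 -> bool}).
(* The background letter is also [a], so [Z] counts as planted in any block. *)
have EZ j : Z = planted a b n j ([ffun=> false] : {ffun 'I_alpha.+1 -> bool}).
  by apply: eq_from_tnth => i; rewrite !tnth_mktuple !ffunE /letter !if_same.
have mL (j : 'I_m) : (j.+1 * alpha.+1 <= n)%N.
  by rewrite (leq_trans _ (leq_trunc_div n alpha.+1)) // leq_mul2r ltn_ord orbT.
have count_spell x : count_mem b (spell a b ([ffun=> x] : {ffun 'I_alpha.+1 -> bool})) =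
    (x * alpha.+1)%N.
  rewrite count_map (eq_count (a2 := fun=> x)); last first.
    by move=> i /=; rewrite ffunE; case: x; rewrite /letter /= ?eqxx ?(negbTE ab).
  by case: x; rewrite ?count_predT ?count_pred0 ?mul0n // size_enum_ord mul1n.
have EZB (j : 'I_m) : (alpha < ED Z (B j))%N.
  have := count_edits (pred1 b) (edits_ED Z (B j)).
  rewrite (EZ j) !plantedE // !count_cat !count_spell !count_nseq /= (negbTE ab); lia.
have := @expected_queries_ge Sigma n alpha beta R d T P A unit 'I_m
   (fun=> (Z, Z)) (fun j => (Z, B j)) m%:R^-1 0.
rewrite subr0 card_unit card_ord; apply => //=.
- by move=> _; apply: leq_trans (_ : ED Z Z <= 0)%N _ => //; exact: ED_le.
- rewrite mul0r eq_card0 // => j; rewrite inE; apply/negbTE; rewrite -ltnNge.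
  exact: EZB.
move=> Q D; rewrite invr1 mul1r big_const card_unit /= addr0 -mulrDr.
rewrite -(ler_pM2l mR) mulrA divff ?gt_eqF // mul1r.
apply: (@le_trans _ _ (\sum_(j < m) ((D (view Q Z (B j)))%:R + #|probes alpha Q j|%:R))).
  rewrite mulr_natl -[X in _ *+ X]card_ord -sumr_const; apply: ler_sum => j _.
  case: (posnP #|probes alpha Q j|) => [/eqP|q0].
    rewrite cards_eq0 => /eqP p0; rewrite ler_wpDr // (EZ j).
    rewrite (@view_planted _ a b n _ Q j _ [ffun=> false] _ [ffun=> true]) //.
    by move=> i; rewrite p0 inE.
  apply: (@le_trans _ _ 1); first by case: (D _).
  by rewrite ler_wpDl // ler1n.
by rewrite big_split /= lerD2l -natr_sum ler_nat sum_card_probes.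
Qed.

End LowerBounds.

(** * Small and large [alpha] combined *)

Theorem theorem6p2 (R : realType) :
  exists c : R, 0 < c /\
    forall (n alpha beta : nat),
      (0 < n)%N -> (0 < alpha)%N -> (0 < beta)%N ->
      alpha%:R <= n%:R / 6 :> R -> (beta <= alpha)%N ->
    forall (Sigma : eqType) (a b : Sigma), a != b ->
    forall (d : measure_display) (T : measurableType d)
      (P : probability T R) (A : nonadaptive_alg Sigma n T),
      ((c * (n%:R * Num.sqrt beta%:R / alpha%:R))%:E
         <= expected_queries P A)%E
      \/ exists X Y : n.-tuple Sigma,
           ((1 / 3)%:E < error_probability alpha beta P A X Y)%E.
Proof.
(* Small [alpha] allows any constant up to 1 / (3 * 4 * 19), large [alpha] any up to 1 / (4 * 12 *
   2). *)
exists 300^-1; split; first by rewrite invr_gt0.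
move=> n alpha beta n0 al0 be0 aln ba Sigma a b ab d T P A.
have {}aln : (6 * alpha <= n)%N.
  by rewrite -(ler_nat R) natrM mulrC -ler_pdivlMr.
case: (pselect (exists X Y : n.-tuple Sigma,
    ((1 / 3)%:E < error_probability alpha beta P A X Y)%E)) => [|good]; first by right.
left; have {good} err X Y : (error_probability alpha beta P A X Y <= (1 / 3)%:E)%E.
  by rewrite leNgt; apply/negP => h; apply: good; exists X, Y.
have scale (K k : R) : 0 < K -> (k%:E <= K^-1%:E * expected_queries P A)%E ->
    ((K * k)%:E <= expected_queries P A)%E.
  move=> K0 /(lee_wpmul2l (_ : 0 <= K%:E)%E); rewrite lee_fin => /(_ (ltW K0)).
  by rewrite muleA -!EFinM divff ?gt_eqF // mul1e.
have alR : 0 < alpha%:R :> R by rewrite ltr0n.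
set s := Num.sqrt _; have s0 : 0 <= s := sqrtr_ge0 _.
have [small|large] := ltnP alpha 330.
  have aln1 : (alpha < n)%N by lia.
  apply: le_trans (scale _ _ _ (queries_constant_block ab err aln1)).
    rewrite lee_fin.
    (* Here [beta <= alpha < 330 < 19 ^ 2]. *)
    have s19 : s <= 19.
      rewrite -(ler_pXn2r (n := 2)) ?nnegrE // sqr_sqrtr // -natrX ler_nat; lia.
    (* With [m >= 1] blocks, [n < (m + 1) * (alpha + 1)], which is at most [2 * m * (2 * alpha)]. *)
    have : (n <= 4 * (n %/ alpha.+1) * alpha)%N.
      have := divn_eq n alpha.+1; have := ltn_pmod n (ltn0Sn alpha).
      have : (0 < n %/ alpha.+1)%N by rewrite divn_gt0.
      move: (n %/ alpha.+1)%N (n %% alpha.+1)%N => m k; nia.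
    rewrite -(ler_nat R) !natrM => nm.
    have nq : n%:R / alpha%:R <= 4 * (n %/ alpha.+1)%:R :> R by rewrite ler_pdivrMr.
    rewrite mulrAC; have : 0 <= n%:R / alpha%:R :> R by rewrite divr_ge0.
    move: nq; set u := n%:R / _; set v := (_ %/ _)%:R => nq u0.
    have : u * s <= u * 19 by rewrite ler_wpM2l.
    lra.
  by rewrite ltr0n divn_gt0.
apply: le_trans (scale _ _ _ (queries_random_block ab err large aln ba)).
  rewrite lee_fin.
  have : (n <= 12 * (n %/ (6 * alpha)) * alpha)%N.
    have d0 : (0 < 6 * alpha)%N by lia.
    have := divn_eq n (6 * alpha); have := ltn_pmod n d0.
    have : (0 < n %/ (6 * alpha))%N by rewrite divn_gt0.
    move: (n %/ (6 * alpha))%N (n %% (6 * alpha))%N => m k; nia.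
  rewrite -(ler_nat R) !natrM => nm.
  have nq : n%:R / alpha%:R <= 12 * (n %/ (6 * alpha))%:R :> R by rewrite ler_pdivrMr.
  set r := Num.sqrt _; have r0 : 0 <= r := sqrtr_ge0 _.
  have sr : s <= 2 * r.
    rewrite -(ler_pXn2r (n := 2)) ?nnegrE ?mulr_ge0 // exprMn !sqr_sqrtr //.
    by rewrite -natrX -natrM ler_nat; lia.
  rewrite mulrAC; have : 0 <= n%:R / alpha%:R :> R by rewrite divr_ge0.
  move: nq; set u := n%:R / _; set v := (_ %/ _)%:R => nq u0.
  have us : u * s <= (12 * v) * (2 * r) by rewrite ler_pM.
  have vr : 0 <= v * r by rewrite mulr_ge0.
  lra.
by rewrite mulr_gt0 ?sqrtr_gt0 ?ltr0n // divn_gt0; lia.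
Qed.
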